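(* Let $f_i \in \Gamma_0(\mathbb{R}^{n_i})$ and let $A_i$ be a real $m\times n_i$ matrix for $i=1,\dots,s$, and let $b\in A\big(\mathrm{ri}(\mathrm{dom}(\sum_{i=1}^s f_i))\big)$. If $x=(x_1,\dots,x_s)\in\mathbb{R}^{n_1}\times\cdots\times\mathbb{R}^{n_s}$ is a solution of $$\min\Big\{\sum_{i=1}^s f_i(x_i):\ \sum_{i=1}^s A_ix_i=b,\ x_i\in\mathbb{R}^{n_i},\ i=1,\dots,s\Big\},\qquad (\star)$$ then for any $\beta>0$ and $\alpha_i>0$, $i=1,\dots,s$, there exists a vector $y\in\mathbb{R}^m$ such that $$x_i=\mathrm{prox}_{\frac{\alpha_i}{\beta}f_i}\Big(x_i-\frac{\alpha_i}{\beta}A_i^\top y\Big),\quad i=1,\dots,s,\qquad y=\mathrm{prox}_{\beta\iota_C^*}\Big(y+\beta\sum_{i=1}^sA_ix_i\Big).\qquad(\star\star)$$ Conversely, if there exist $\beta>0$, $\alpha_i>0$ for $i=1,\dots,s$, $x=(x_1,\dots,x_s)\in\mathbb{R}^{n_1}\times\cdots\times\mathbb{R}^{n_s}$ and $y\in\mathbb{R}^m$ satisfying the equations $(\star\star)$, then $x$ is a solution of problem $(\star)$.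
   Context: $s,m,n_1,\dots,n_s$ are positive integers, $n=\sum_{i=1}^s n_i$, and $\mathbb{R}^n$ is identified with $\mathbb{R}^{n_1}\times\cdots\times\mathbb{R}^{n_s}$. $\Gamma_0(\mathbb{R}^d)$ is the class of proper lower semicontinuous convex functions $\mathbb{R}^d\to\mathbb{R}\cup\{+\infty\}$. $A=[A_1\ A_2\ \cdots\ A_s]$ is the $m\times n$ matrix with blocks $A_i$. $\sum_{i=1}^s f_i$ denotes the function $x\mapsto\sum_i f_i(x_i)$ on $\mathbb{R}^n$, $\mathrm{dom}$ its effective domain and $\mathrm{ri}$ the relative interior. $C=\{b\}$; $\iota_C$ is the indicator function of $C$ ($0$ on $C$, $+\infty$ elsewhere). The conjugate of $\varphi$ is $\varphi^*(y)=\sup_x\{\langle x,y\rangle-\varphi(x)\}$. For $\varphi\in\Gamma_0(\mathbb{R}^d)$, $\mathrm{prox}_\varphi(x)=\mathrm{argmin}\{\frac12\|u-x\|_2^2+\varphi(u):u\in\mathbb{R}^d\}$. *)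

(* Defs.v *)
From HB Require Import structures.
From mathcomp Require Import all_boot all_order all_algebra.
From mathcomp Require Import all_classical all_reals all_analysis.

Set Implicit Arguments.
Unset Strict Implicit.
Unset Printing Implicit Defensive.

Import Order.TTheory GRing.Theory Num.Theory.
Import numFieldNormedType.Exports.

Local Open Scope classical_set_scope.
Local Open Scope ring_scope.

(* The vectors of R^d are the columns 'cV[R]_d, with the topology of the
   library. The library norm `|u| on 'cV[R]_d is the sup norm, so the Euclidean
   norm is expressed with dot: dot u u is its square. *)
Definition dot (R : realType) (d : nat) (u v : 'cV[R]_d) : R :=
  \sum_(k < d) u k 0 * v k 0.

(* The codomain R `|` {+oo} is \bar R, with the value -oo ruled out by
   proper_fun. *)
Definition edom (R : realType) (T : Type) (f : T -> \bar R) : set T :=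
  [set x | (f x < +oo)%E].

Definition proper_fun (R : realType) (T : Type) (f : T -> \bar R) : Prop :=
  (forall x, f x != -oo%E) /\ edom f !=set0.

(* The parameter t stays in ]0, 1[, so that the products by t and 1 - t do not
   involve the convention 0 * +oo = 0. *)
Definition econvex (R : realType) (V : lmodType R) (f : V -> \bar R) : Prop :=
  forall (x y : V) (t : R), 0 < t < 1 ->
    (f (t *: x + (1 - t) *: y)%R <= t%:E * f x + (1 - t)%:E * f y)%E.

Definition Gamma0 (R : realType) (d : nat) : set ('cV[R]_d -> \bar R) :=
  [set f : 'cV[R]_d -> \bar R |
    [/\ proper_fun f, lower_semicontinuous f & econvex f]].

Definition affine_set (R : realType) (d : nat) (M : set 'cV[R]_d) : Prop :=
  forall (x y : 'cV[R]_d) (t : R), M x -> M y -> M (t *: x + (1 - t) *: y).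

Definition affine_hull (R : realType) (d : nat) (S : set 'cV[R]_d) :
    set 'cV[R]_d :=
  \bigcap_(M in [set M | affine_set M /\ S `<=` M]) M.

Definition rel_interior (R : realType) (d : nat) (S : set 'cV[R]_d) :
    set 'cV[R]_d :=
  [set x | S x /\ \forall y \near x, affine_hull S y -> S y].

Definition indic_fun (R : realType) (T : Type) (C : set T) : T -> \bar R :=
  fun x => if x \in C then 0%E else +oo%E.

Definition conjugate (R : realType) (d : nat) (f : 'cV[R]_d -> \bar R) :
    'cV[R]_d -> \bar R :=
  fun y => ereal_sup [set ((dot x y)%:E - f x)%E | x in [set: 'cV[R]_d]].

Definition argmin (R : realType) (T : Type) (D : set T) (F : T -> \bar R) :
    set T :=
  [set u | D u /\ forall v, D v -> (F u <= F v)%E].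

(* For f in Gamma0 the set of minimizers is a singleton, and prox f x is its
   unique element; the default value 0 is taken only when there is no
   minimizer. *)
Definition prox (R : realType) (d : nat) (f : 'cV[R]_d -> \bar R)
    (x : 'cV[R]_d) : 'cV[R]_d :=
  xget 0 (argmin setT
    (fun u => ((2^-1 * dot (u - x) (u - x))%:E + f u)%E)).

(* x |-> \sum_i f_i(x_i) on R^n, n = \sum_i n_i, where the block x_i of the
   column x is submxcol x i. *)
Definition block_sum (R : realType) (s : nat) (n_ : 'I_s -> nat)
    (f : forall i, 'cV[R]_(n_ i) -> \bar R) :
    'cV[R]_(\sum_(i < s) n_ i)%N -> \bar R :=
  fun x => (\sum_(i < s) f i (submxcol x i))%E.

Definition is_solution (R : realType) (s m : nat) (n_ : 'I_s -> nat)
    (f : forall i, 'cV[R]_(n_ i) -> \bar R) (A : forall i, 'M[R]_(m, n_ i))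
    (b : 'cV[R]_m) (x : forall i, 'cV[R]_(n_ i)) : Prop :=
  argmin [set z : forall i, 'cV[R]_(n_ i) | \sum_(i < s) A i *m z i = b]
    (fun z => (\sum_(i < s) f i (z i))%E) x.

Definition fixed_point_eqs (R : realType) (s m : nat) (n_ : 'I_s -> nat)
    (f : forall i, 'cV[R]_(n_ i) -> \bar R) (A : forall i, 'M[R]_(m, n_ i))
    (b : 'cV[R]_m) (beta : R) (alpha : 'I_s -> R)
    (x : forall i, 'cV[R]_(n_ i)) (y : 'cV[R]_m) : Prop :=
  (forall i, x i = prox (fun u => ((alpha i / beta)%:E * f i u)%E)
                        (x i - (alpha i / beta) *: ((A i)^T *m y))) /\
  y = prox (fun u => (beta%:E * conjugate (@indic_fun R _ [set b]) u)%E)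
           (y + beta *: \sum_(i < s) A i *m x i).

(* Main.v *)
Require Import Defs.
From HB Require Import structures.
From mathcomp Require Import all_boot all_order all_algebra.
From mathcomp Require Import all_classical all_reals all_analysis.
From mathcomp Require Import ring lra.

Import Order.TTheory GRing.Theory Num.Theory.
Import numFieldNormedType.Exports.

Set Implicit Arguments.
Unset Strict Implicit.
Unset Printing Implicit Defensive.

Local Open Scope classical_set_scope.
Local Open Scope ring_scope.

(** For convex functions the equations are a reformulation of the optimality
    conditions (KKT)

      sum_i A_i x_i = b  and  f_i(x_i) <= f_i(u) + <A_i^T y, u - x_i>

    for all i and u, in which neither beta nor the alpha_i appear. Indeed
    x = prox_phi(x - p) says that -p is a subgradient of phi at x [eq_proxP]:
    the squared distance grows to second order along a segment issued from x,
    so convexity leaves only its linear part. With phi = (alpha_i / beta) f_i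
    this gives the subgradient inequalities, scaled by alpha_i / beta. The
    conjugate of the indicator of {b} is the linear form <b, .>, whose only
    subgradient is b, so the equation on y says that x is feasible.

    Summing the inequalities over a feasible z cancels the y-terms, so KKT
    implies optimality [KKT_solution]. The converse [solution_KKT] is the
    existence of Lagrange multipliers, the only place where the relative
    interior matters. For a single constraint g = 0 a multiplier is a number
    separating two families of slopes, and the minimality of x on {g = 0} says
    exactly that the families are in order; the relative interior ensures that
    if g is not constantly 0 on the domain, then it takes both signs, so that
    neither family is empty while the other is not [affine_multiplier]. The m
    rows of A z - b are then absorbed into the objective one at a time
    [lagrange_multipliers], which spares any separation theorem in R^m.

    Since prox is a chosen minimizer with a default value, the implication from
    the equations to KKT needs the minimizer to exist [prox_ex]. It is obtained
    by compactness, after bounding phi below by a function of linear growth,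
    which the squared distance dominates. *)

(** * Lagrange multipliers for affine constraints *)

Section Lagrange.
Context {R : realType} {V : lmodType R}.
Implicit Types (D : set V) (phi g : V -> R).

Definition convex_on D phi : Prop :=
  forall (x y : V) (t : R), 0 < t < 1 -> D x -> D y ->
    D (t *: x + (1 - t) *: y) /\
    phi (t *: x + (1 - t) *: y) <= t * phi x + (1 - t) * phi y.

Definition affine_fun g : Prop :=
  forall (x y : V) (t : R),
    g (t *: x + (1 - t) *: y) = t * g x + (1 - t) * g y.

(** For a convex set of finite dimension this is the relative interior. This
    purely algebraic form survives the intersection of D with a hyperplane
    through z0, which the induction on the constraints relies on. *)
Definition prolongable D : set V :=
  [set z0 | D z0 /\ forall z, D z ->
     exists2 t : R, 1 < t & D (t *: z0 + (1 - t) *: z)].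

(** On {g > 0} the multiplier y must be at least the slope (v - phi) / g, and
    on {g < 0} at most that slope. Joining a point of each region by a segment,
    which meets {g = 0}, shows that every slope of the first kind is below
    every slope of the second kind, so the supremum of the first ones works.
    This needs a point in {g < 0} as soon as there is one in {g > 0}, and
    conversely: prolonging the segment towards z0 provides it. *)
Lemma affine_multiplier D phi g (z0 : V) (v : R) :
  convex_on D phi -> affine_fun g -> prolongable D z0 -> g z0 = 0 ->
  (forall z, D z -> g z = 0 -> v <= phi z) ->
  exists y : R, forall z, D z -> v <= phi z + y * g z.
Proof.
move=> cvx aff [Dz0 prol] gz0 vmin.
have opp z : D z -> g z != 0 -> exists2 z', D z' & g z * g z' < 0.
  move=> Dz gz; have [t t1 Dt] := prol _ Dz.
  exists (t *: z0 + (1 - t) *: z) => //.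
  rewrite aff gz0 mulr0 add0r mulrCA -expr2 nmulr_rlt0 ?subr_lt0//.
  by rewrite exprn_even_gt0.
have slope z1 z2 : D z1 -> D z2 -> g z1 < 0 -> 0 < g z2 ->
    (v - phi z2) / g z2 <= (v - phi z1) / g z1.
  move=> D1 D2 g1 g2.
  (* the weight for which g vanishes on the segment [z2, z1] *)
  pose t := g z2 / (g z2 - g z1).
  have dgt0 : 0 < g z2 - g z1 by lra.
  have t01 : 0 < t < 1 by rewrite /t divr_gt0//= ltr_pdivrMr// mul1r; lra.
  have [D3 phi3] := cvx _ _ _ t01 D1 D2.
  have te : t * (g z2 - g z1) = g z2 by rewrite /t divfK// gt_eqF.
  have g3 : g (t *: z1 + (1 - t) *: z2) = 0 by rewrite aff; lra.
  have := le_trans (vmin _ D3 g3) phi3.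
  rewrite -(ler_pM2r dgt0).
  have -> : (t * phi z1 + (1 - t) * phi z2) * (g z2 - g z1)
      = t * (g z2 - g z1) * phi z1
        + (g z2 - g z1 - t * (g z2 - g z1)) * phi z2 by ring.
  rewrite te.
  by rewrite ler_ndivlMr// mulrAC ler_pdivlMr//; lra.
have [[zp Dzp gzp]|nopos] := pselect (exists2 z, D z & 0 < g z); last first.
  exists 0 => z Dz; rewrite mul0r addr0; apply: vmin => //.
  apply/eqP/negP => /negP gz; have [z' Dz' gg] := opp z Dz gz.
  have [gp|gn] := ltrP 0 (g z); first by apply: nopos; exists z.
  by apply: nopos; exists z' => //; nra.
have [zn Dzn gzn] : exists2 z, D z & g z < 0.
  by have [||z' Dz' gg] := opp zp => //; [rewrite gt_eqF|exists z' => //; nra].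
pose S := [set (v - phi z) / g z | z in D `&` [set z | 0 < g z]].
have S0 : S !=set0 by exists ((v - phi zp) / g zp); exists zp.
have ubS z : D z -> g z < 0 -> ubound S ((v - phi z) / g z).
  by move=> Dz gz _ [z2 [Dz2 g2] <-]; apply: slope.
exists (sup S) => z Dz; have [gp|gn|g0] := ltrgt0P (g z); last first.
- by rewrite g0 mulr0 addr0 vmin.
- have := ge_sup S0 (ubS z Dz gn).
  by rewrite ler_ndivlMr//; lra.
- have : (v - phi z) / g z <= sup S.
    apply: sup_upper_bound; last by exists z.
    by split=> //; exists ((v - phi zn) / g zn); apply: ubS.
  by rewrite ler_pdivrMr//; lra.
Qed.

(** Induction on the number of constraints: on the slice {g_0 = 0} the other
    constraints have multipliers, and adding these terms to phi leaves the
    single constraint g_0 on D. *)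
Lemma lagrange_multipliers (m : nat) (g : 'I_m -> V -> R) D phi (z0 : V)
    (v : R) :
  convex_on D phi -> (forall i, affine_fun (g i)) -> prolongable D z0 ->
  (forall i, g i z0 = 0) ->
  (forall z, D z -> (forall i, g i z = 0) -> v <= phi z) ->
  exists y : 'I_m -> R, forall z, D z ->
    v <= phi z + \sum_(i < m) y i * g i z.
Proof.
elim: m g D phi => [|m IH] g D phi cvx aff [Dz0 prol] gz0 vmin.
  by exists (fun=> 0) => z Dz; rewrite big_ord0 addr0; apply: vmin => // -[].
pose D' := D `&` [set z | g ord0 z = 0].
have [|||||y' Hy'] := IH (fun i => g (lift ord0 i)) D' phi.
- move=> x y t t01 [Dx gx] [Dy gy]; have [Dt phit] := cvx _ _ _ t01 Dx Dy.
  by split=> //; split=> //=; rewrite aff gx gy !mulr0 addr0.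
- by move=> i; apply: aff.
- split=> [|z [Dz gz]]; first by split=> //; apply: gz0.
  have [t t1 Dt] := prol _ Dz; exists t => //; split=> //=.
  by rewrite aff gz gz0 !mulr0 addr0.
- by move=> i; apply: gz0.
- move=> z [Dz gz] g'z; apply: vmin => // i.
  by have [j ->|->] := unliftP ord0 i.
pose psi z := phi z + \sum_(i < m) y' i * g (lift ord0 i) z.
have [|||||y0 Hy0] := @affine_multiplier D psi (g ord0) z0 v.
- move=> x y t t01 Dx Dy; have [Dt phit] := cvx _ _ _ t01 Dx Dy.
  split=> //; rewrite /psi !mulrDr addrACA lerD// !mulr_sumr -big_split/=.
  by apply: ler_sum => i _; rewrite aff; lra.
- exact: aff.
- by split.
- exact: gz0.
- by move=> z Dz gz; apply: Hy'.
exists (fun i => if unlift ord0 i is Some j then y' j else y0) => z Dz.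
rewrite big_ord_recl unlift_none.
under eq_bigr do rewrite liftK.
by have := Hy0 _ Dz; rewrite /psi; lra.
Qed.

End Lagrange.

(** * Lower semicontinuous functions *)

Section LowerSemicontinuity.
Context {R : realType} {X : topologicalType}.
Local Open Scope ereal_scope.

Lemma lsc_continuousD (g : X -> R) (f : X -> \bar R) :
  continuous g -> lower_semicontinuous f ->
  lower_semicontinuous (fun x => (g x)%:E + f x).
Proof.
move=> gc fl x a ax.
(* a' splits the gap a < g x + f x between f and g *)
have [a' aa' a'f] : exists2 a' : R, (a - g x < a')%R & a'%:E < f x.
  move: ax; case: (f x) => [r| |] //=.
    rewrite -EFinD lte_fin => ax.
    by exists ((a - g x + r) / 2)%R; rewrite ?lte_fin; lra.
  by move=> _; exists (a - g x + 1)%R; rewrite ?ltry//; lra.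
have [W Wx Wf] := fl _ _ a'f.
have gx : \forall y \near x, (a - a' < g y)%R.
  by apply: (cvgr_gt (g x)); [exact: gc|lra].
exists (W `&` [set y | (a - a' < g y)%R]); first exact: filterI.
move=> y [Wy ay]; rewrite -[a](subrK a') EFinD.
by apply: lteD; [rewrite lte_fin|exact: Wf].
Qed.

Lemma lsc_pscale (c : R) (f : X -> \bar R) :
  (0 < c)%R -> lower_semicontinuous f ->
  lower_semicontinuous (fun x => c%:E * f x).
Proof.
move=> c0 fl x a; rewrite -lte_pdivrMl// -EFinM => ax.
have [W Wx Wf] := fl _ _ ax; exists W => // y Wy.
by rewrite -lte_pdivrMl// -EFinM Wf.
Qed.

(** The sublevel sets at the levels above the infimum form a filter on K; a
    cluster point of it cannot have a value above the infimum. *)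
Lemma lsc_compact_min (K : set X) (f : X -> \bar R) :
  compact K -> K !=set0 -> lower_semicontinuous f ->
  exists2 p, K p & forall x, K x -> f p <= f x.
Proof.
move=> Kc [x0 Kx0] fl; pose m := ereal_inf (f @` K).
have mlb x : K x -> m <= f x by move=> Kx; apply: ereal_inf_lbound; exists x.
have [my|] := eqVneq m +oo.
  exists x0 => // x Kx; apply: le_trans (leey _) _; rewrite -my; exact: mlb.
rewrite -ltey => moo.
pose F := filter_from [set a : R | m < a%:E]
            (fun a => K `&` [set x | f x <= a%:E]).
have exK a : m < a%:E -> exists x, K x /\ f x <= a%:E.
  by move=> /ereal_inf_lt [_ [x Kx <-] /ltW]; exists x.
have m_real : exists a : R, m < a%:E.
  move: moo; case: (m) => [r| |]// _.
    by exists (r + 1)%R; rewrite lte_fin; lra.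
  by exists 0%R; rewrite ltNye.
have FF : ProperFilter F.
  apply: filter_from_proper => [|a /exK[x [Kx fx]]]; last by exists x.
  apply: filter_from_filter => // a b ma mb.
  exists (Num.min a b); first by rewrite /= EFin_min lt_min ma.
  by move=> x [Kx /=]; rewrite EFin_min le_min => /andP[fa fb].
have FK : F K by have [a ma] := m_real; exists a => // x [].
have [p [Kp pF]] := Kc F FF FK.
exists p => // x Kx; apply: le_trans (mlb _ Kx).
rewrite leNgt; apply/negP => mp.
have [a ma ap] : exists2 a : R, m < a%:E & a%:E < f p.
  move: mp moo; case: (m) => [r| |]//; case: (f p) => [q| |]//.
  - by rewrite lte_fin => rq; exists ((r + q) / 2)%R; rewrite lte_fin; lra.
  - by exists (r + 1)%R; rewrite ?ltry// lte_fin; lra.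
  - by exists (q - 1)%R; rewrite ?ltNyr// lte_fin; lra.
  - by exists 0%R; rewrite ?ltry ?ltNyr.
have [W Wp Wf] := fl _ _ ap.
have Fa : F (K `&` [set x | f x <= a%:E]) by exists a.
have [z [[_ /= fz] Wz]] := pF _ _ Fa Wp.
by have := Wf _ Wz; rewrite ltNge fz.
Qed.

End LowerSemicontinuity.

(** * The Euclidean structure of column vectors *)

Section Euclidean.
Context {R : realType} {d : nat}.
Implicit Types u v w : 'cV[R]_d.

Lemma dotC u v : dot u v = dot v u.
Proof. by apply: eq_bigr => k _; rewrite mulrC. Qed.

Lemma dotDl u v w : dot (u + v) w = dot u w + dot v w.
Proof. by rewrite -big_split; apply: eq_bigr => k _; rewrite mxE mulrDl. Qed.

Lemma dotZl (a : R) u v : dot (a *: u) v = a * dot u v.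
Proof. by rewrite mulr_sumr; apply: eq_bigr => k _; rewrite mxE mulrA. Qed.

Lemma dotNl u v : dot (- u) v = - dot u v.
Proof. by rewrite -scaleN1r dotZl mulN1r. Qed.

Lemma dotDr u v w : dot u (v + w) = dot u v + dot u w.
Proof. by rewrite !(dotC u) dotDl. Qed.

Lemma dotNr u v : dot u (- v) = - dot u v.
Proof. by rewrite !(dotC u) dotNl. Qed.

Lemma dotZr (a : R) u v : dot u (a *: v) = a * dot u v.
Proof. by rewrite !(dotC u) dotZl. Qed.

Lemma dot0l u : dot 0 u = 0.
Proof. by rewrite -(scale0r u) dotZl mul0r. Qed.

Lemma dot0r u : dot u 0 = 0.
Proof. by rewrite dotC dot0l. Qed.

Definition dotE := (dotDl, dotDr, dotNl, dotNr, dotZl, dotZr).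

Lemma dot_ge0 u : 0 <= dot u u.
Proof. by apply: sumr_ge0 => k _; rewrite -expr2 sqr_ge0. Qed.

Lemma dot_gt0 u : u != 0 -> 0 < dot u u.
Proof.
move=> u0; rewrite lt_def dot_ge0 andbT; apply: contra u0 => /eqP u0.
apply/eqP/colP => k; rewrite mxE; apply/eqP; rewrite -sqrf_eq0 expr2.
by apply/eqP/(psumr_eq0P _ u0) => // i _; rewrite -expr2 sqr_ge0.
Qed.

(** The sup norm is attained at some coordinate. *)
Lemma sqr_norm_le_dot u : `|u| ^+ 2 <= dot u u.
Proof.
have [->|] := eqVneq `|u| 0; first by rewrite expr0n dot_ge0.
move=> /mx_norm_neq0[[k j] /= uk]; rewrite {1}/Num.norm/= uk ord1.
rewrite real_normK ?num_real// /dot (bigD1 k)//= expr2 lerDl.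
by apply: sumr_ge0 => i _; rewrite -expr2 sqr_ge0.
Qed.

Lemma dot_continuous (p : 'cV[R]_d) : continuous (dot p).
Proof.
apply: continuous_big => [|k _ u]; first exact: add_continuous.
apply: (@continuousM _ _ (fun=> p k 0) (fun v : 'cV[R]_d => v k 0)).
  exact: cst_continuous.
exact: coord_continuous.
Qed.

Lemma dist_sqr_continuous (p : 'cV[R]_d) :
  continuous (fun u => dot (u - p) (u - p)).
Proof.
apply: continuous_big => [|k _ u]; first exact: add_continuous.
have cont : {for u, continuous (fun v : 'cV[R]_d => (v - p) k 0)}.
  rewrite (_ : (fun v => _) = (fun v : 'cV[R]_d => v k 0 - p k 0)); last first.
    by apply/funext => v; rewrite !mxE.
  apply: (@continuousB _ _ _ (fun v : 'cV[R]_d => v k 0) (fun=> p k 0)).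
    exact: coord_continuous.
  exact: cst_continuous.
exact: (continuousM cont cont).
Qed.

Lemma cV_ball_compact (c : 'cV[R]_d) (r : R) : compact [set u | `|u - c| <= r].
Proof.
pose B := [set v : 'rV[R]_d | forall i, v ord0 i \in `[- r, r]].
have Bc : compact B.
  apply: (@rV_compact _ _ (fun=> `[- r, r]%classic)) => _.
  exact: segment_compact.
have trc : continuous (fun v : 'rV[R]_d => v^T + c).
  move=> v; apply: (@continuousD _ _ _ (fun v : 'rV[R]_d => v^T) (fun=> c));
    last exact: cst_continuous.
  move=> W [P vP PW]; exists (fun i j => P j i) => [i j|w wP].
    by have := vP j i; rewrite mxE.
  by apply: PW => i j; rewrite mxE; apply: wP.
have [rlt0|r0] := ltrP r 0.
  rewrite (_ : mkset _ = set0); first exact: compact0.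
  by apply/seteqP; split=> u //= /le_lt_trans/(_ rlt0); rewrite normr_lt0.
suff -> : [set u | `|u - c| <= r] = (fun v : 'rV[R]_d => v^T + c) @` B.
  by apply: continuous_compact => //; exact: continuous_subspaceT.
apply/seteqP; split=> [u /= ur|_ [v /= vB <-]].
  exists (u - c)^T; last by rewrite trmxK subrK.
  move=> i; rewrite mxE in_itv/= -ler_norml; apply: le_trans ur.
  rewrite [leRHS]/Num.norm/= mx_normrE.
  by apply/bigmax_geP; right => /=; exists (i, ord0).
rewrite /= addrK /Num.norm/= mx_normrE.
apply/bigmax_leP; split=> //= -[i j] _ /=.
by rewrite ord1 mxE ler_norml; have := vB i; rewrite in_itv.
Qed.

End Euclidean.

(** * Proximal points *)

Section Prox.
Context {R : realType} {d : nat}.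
Implicit Types (phi : 'cV[R]_d -> \bar R) (x p u : 'cV[R]_d).

Lemma Gamma0_pscale (c : R) phi :
  0 < c -> Gamma0 phi -> Gamma0 (fun u => c%:E * phi u)%E.
Proof.
move=> c0 [[phiN [u0 phi0]] philsc phicvx].
have scaleN (t : R) u : 0 < t -> (t%:E * phi u)%E != -oo%E.
  by move=> t0; case: (phi u) (phiN u) => [r| |]//= _; rewrite gt0_muley.
split.
- split=> [x|]; first exact: scaleN.
  exists u0; move: phi0; rewrite /edom/=.
  by case: (phi u0) (phiN u0) => [r| |]//= _ _; rewrite -EFinM ltry.
- exact: lsc_pscale.
- move=> u v t t01; have /andP[t0 t1] := t01.
  rewrite muleCA [X in (_ <= _ + X)%E]muleCA -muleDr//; last first.
    by apply: ltninfty_adde_def; rewrite inE ltNye scaleN//; lra.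
  by rewrite lee_pmul2l// phicvx.
Qed.

(** Let M be the minimum of phi on the unit ball around a point x0 of its
    domain. A convex function that goes from phi x0 to at least M over a unit
    distance keeps a slope of at least M - phi x0 further on, so phi is bounded
    below by M - (phi x0 - M) |u - x0|. The quadratic term then exceeds the
    value at x0 outside a large ball, and on that ball the minimum is attained
    by compactness. *)
Lemma prox_ex phi x : Gamma0 phi ->
  argmin setT (fun u => (2^-1 * dot (u - x) (u - x))%:E + phi u)%E !=set0.
Proof.
move=> [[phiN [x0 phi0]] philsc phicvx].
pose F u := ((2^-1 * dot (u - x) (u - x))%:E + phi u)%E.
have Flsc : lower_semicontinuous F.
  apply: lsc_continuousD => // u.
  suff: {for u, continuous
      ((fun=> 2^-1 : R) \* (fun v => dot (v - x) (v - x)))} by [].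
  by apply: continuousM; [exact: cst_continuous|exact: dist_sqr_continuous].
have phi0fin : phi x0 \is a fin_num by rewrite fin_numE phiN/= lt_eqF.
have ball_n0 (r : R) : 0 <= r -> [set u | `|u - x0| <= r] !=set0.
  by move=> r0; exists x0; rewrite /= subrr normr0.
pose a := fine (phi x0).
have phi0E : phi x0 = a%:E by rewrite fineK.
have [p p1 pmin] :=
  lsc_compact_min (@cV_ball_compact _ _ x0 1) (ball_n0 1 ler01) philsc.
have pa : (phi p <= a%:E)%E by rewrite -phi0E pmin//= subrr normr0.
pose M := fine (phi p).
have pE : phi p = M%:E.
  by rewrite fineK// fin_numE phiN/= lt_eqF// (le_lt_trans pa)// ltry.
have Ma : M <= a by rewrite -lee_fin -pE.
have minorant u : ((M - (a - M) * `|u - x0|)%:E <= phi u)%E.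
  have [r1|r1] := lerP `|u - x0| 1.
    apply: le_trans (pmin u r1); rewrite pE lee_fin.
    by rewrite gerBl mulr_ge0//; lra.
  set r := `|u - x0| in r1 *.
  have r0 : 0 < r by lra.
  have t01 : 0 < r^-1 < 1 by rewrite invr_gt0 r0 invf_lt1.
  have := phicvx u x0 _ t01; rewrite phi0E.
  (* the point of the segment [x0, u] at distance 1 from x0 *)
  have inball : `|r^-1 *: u + (1 - r^-1) *: x0 - x0| <= 1.
    have -> : r^-1 *: u + (1 - r^-1) *: x0 - x0 = r^-1 *: (u - x0).
      by rewrite scalerBl scale1r scalerBr -addrA addrAC subrr add0r.
    by rewrite normrZ gtr0_norm ?invr_gt0// -/r mulVf// gt_eqF.
  move=> /(le_trans (pmin _ inball)); rewrite pE.
  case: (phi u) (phiN u) => [q| |] //= _; last by rewrite leey.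
  rewrite -!EFinM -EFinD !lee_fin => H.
  have : r * M <= r * (r^-1 * q + (1 - r^-1) * a) by rewrite ler_pM2l.
  have -> : r * (r^-1 * q + (1 - r^-1) * a) = q + (r - 1) * a.
    by field; rewrite gt_eqF.
  by nra.
(* With t = |u - x0| - D, a lower bound of |u - x|, the growth to check is
   t^2 / 2 - k t >= c: it holds when t >= 2 k + 2 + c, since then
   t / 2 >= 1 and t - 2 k >= c. *)
pose k := a - M.
pose D := `|x - x0|.
pose F0 := 2^-1 * dot (x0 - x) (x0 - x) + a.
pose c := `|k * D - M + F0|.
pose rho := D + 2 * k + 2 + c.
have D0 : 0 <= D by rewrite /D.
have c0 : 0 <= c by rewrite /c.
have k0 : 0 <= k by rewrite /k; lra.
have rho0 : 0 <= rho by rewrite /rho; lra.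
have [q qrho qmin] :=
  lsc_compact_min (@cV_ball_compact _ _ x0 rho) (ball_n0 rho rho0) Flsc.
exists q; split=> // u _; have [ur|ur] := lerP `|u - x0| rho; first exact: qmin.
have qF0 : (F q <= F0%:E)%E.
  by have := qmin x0; rewrite /= subrr normr0 => /(_ rho0); rewrite {2}/F phi0E.
apply: le_trans qF0 _.
apply: (@le_trans _ _ ((2^-1 * dot (u - x) (u - x))%:E
    + (M - k * `|u - x0|)%:E)%E); last by apply: leeD => //; exact: minorant.
rewrite -EFinD lee_fin.
set r := `|u - x0| in ur *.
have rD : r - D <= `|u - x|.
  rewrite lerBlDr /r /D; apply: le_trans (ler_normD _ _).
  by rewrite addrA subrK.
have sq : (r - D) ^+ 2 <= dot (u - x) (u - x).
  apply: le_trans (sqr_norm_le_dot _); rewrite ler_sqr// nnegrE//.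
  by move: ur; rewrite /rho; lra.
have cE : k * D - M + F0 <= c by exact: ler_norm.
suff : c <= 2^-1 * (r - D) ^+ 2 - k * (r - D) by lra.
have tD : 2 * k + 2 + c <= r - D by move: ur; rewrite /rho; lra.
by set t := r - D in tD *; rewrite expr2; nra.
Qed.

Lemma prox_spec phi x : Gamma0 phi ->
  argmin setT (fun u => (2^-1 * dot (u - x) (u - x))%:E + phi u)%E (prox phi x).
Proof. by move=> G; apply: xgetPex; exact: prox_ex. Qed.

(** The first-order term dominates when t tends to 0. *)
Lemma slope_ge0 (a b : R) :
  (forall t : R, 0 < t < 1 -> 0 <= a + t * b) -> 0 <= a.
Proof.
move=> H; rewrite leNgt; apply/negP => a0.
(* with this t the value a + t * b is at most a / 2 *)
pose s := - a + `|b|; pose t := - a / (2 * s).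
have b0 : 0 <= `|b| by [].
have bb : b <= `|b| by exact: ler_norm.
have s0 : 0 < s by rewrite /s; lra.
have ts : t * s = - a / 2 by rewrite /t; field; rewrite gt_eqF.
have s20 : 0 < 2 * s by lra.
have sa : - a <= s by rewrite /s; lra.
have t0 : 0 < t by rewrite /t divr_gt0//; lra.
have t1 : t < 1 by rewrite /t ltr_pdivrMr//; lra.
have := H t; rewrite t0 t1 => /(_ isT).
have : t * b <= t * s.
  by rewrite ler_pM2l//; apply: (le_trans bb); rewrite /s; lra.
by lra.
Qed.

(** Expanding the square |u - (x - p)|^2 around u = x gives the linear term
    2 <p, u - x> plus |u - x|^2. From left to right, moving a fraction t of the
    way from x to u makes the quadratic term negligible; from right to left, it
    makes x the unique minimizer. *)
Lemma eq_proxP phi x p : Gamma0 phi ->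
  x = prox phi (x - p) <->
  forall u, (phi x <= phi u + (dot p (u - x))%:E)%E.
Proof.
move=> G; have [[phiN [u0 phi0]] _ phicvx] := G.
have sqE u : dot (u - (x - p)) (u - (x - p)) =
    dot (u - x) (u - x) + 2 * dot p (u - x) + dot p p.
  by rewrite opprB addrCA addrC !dotE !(dotC x) !(dotC p); ring.
split=> [xprox u|xmin].
  have [_ xmin] := prox_spec (x - p) G; rewrite -xprox in xmin.
  have xfin : phi x \is a fin_num.
    rewrite fin_numE phiN/=; apply/negP => /eqP xoo.
    have := xmin u0 I; rewrite xoo addey// leye_eq.
    by move: phi0; rewrite /edom/=; case: (phi u0) (phiN u0).
  have xE := fineK xfin; set a := fine (phi x) in xE.
  have [->|uoo] := eqVneq (phi u) +oo%E; first by rewrite leey.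
  have uE : (fine (phi u))%:E = phi u by rewrite fineK// fin_numE phiN.
  set q := fine (phi u) in uE.
  rewrite -xE -uE -EFinD lee_fin.
  suff : 0 <= dot p (u - x) + (q - a) by lra.
  apply: (@slope_ge0 _ (2^-1 * dot (u - x) (u - x))) => t t01.
  have /andP[t0 t1] := t01.
  have := phicvx u x t t01; rewrite -xE -uE -!EFinM -EFinD => cvx.
  have := le_trans (xmin (t *: u + (1 - t) *: x) I) (leeD2l _ cvx).
  rewrite -xE -!EFinD lee_fin !sqE.
  have -> : t *: u + (1 - t) *: x - x = t *: (u - x).
    by rewrite scalerBl scale1r scalerBr addrA addrAC addrK.
  rewrite subrr dot0l dot0r !dotE.
  by move=> H; rewrite -(pmulr_rge0 _ t0); lra.
have xfin : phi x \is a fin_num.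
  rewrite fin_numE phiN/=; apply/negP => /eqP xoo.
  have := xmin u0; rewrite xoo.
  by move: phi0; rewrite /edom/=; case: (phi u0) (phiN u0).
have xE := fineK xfin; set a := fine (phi x) in xE.
(* strong growth at x, which gives minimality and uniqueness at once *)
have grow u : ((2^-1 * dot (x - (x - p)) (x - (x - p)) + a
    + 2^-1 * dot (u - x) (u - x))%:E
    <= (2^-1 * dot (u - (x - p)) (u - (x - p)))%:E + phi u)%E.
  have := xmin u; case: (phi u) (phiN u) => [q| |]// _; last first.
    by rewrite addey ?leey.
  by rewrite -xE -!EFinD !lee_fin !sqE subrr dot0l dot0r; lra.
apply/esym/xget_unique; first split=> // u _.
  apply: le_trans (grow u); rewrite -xE -EFinD lee_fin lerDl.
  by rewrite mulr_ge0// dot_ge0.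
move=> u [_ /(_ x I) umin]; apply/eqP.
rewrite -subr_eq0; apply/negP => /negP ux.
have := le_trans (grow u) umin; rewrite -xE -EFinD lee_fin.
by have := dot_gt0 ux; lra.
Qed.

End Prox.

(** * Optimality conditions *)

Section KKT.
Context {R : realType}.

Lemma sume_lty_fin_num (I : finType) (F : I -> \bar R) :
  (forall i, F i != -oo%E) -> (\sum_i F i < +oo)%E ->
  forall i, F i \is a fin_num.
Proof.
move=> FN Flt i; rewrite fin_numE FN/=; apply: contraTN Flt => /eqP Fi.
rewrite -leNgt leye_eq esum_eqy//.
by apply/existsP; exists i; rewrite Fi eqxx andbT.
Qed.

Lemma dot_trmx (m n : nat) (A : 'M[R]_(m, n)) (y : 'cV[R]_m) (u : 'cV[R]_n) :
  dot (A^T *m y) u = dot y (A *m u).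
Proof.
have dotM d (v w : 'cV[R]_d) : dot v w = (v^T *m w) 0 0.
  by rewrite mxE; apply: eq_bigr => k _; rewrite mxE.
by rewrite !dotM trmx_mul trmxK mulmxA.
Qed.

Lemma dot_sumr (I : Type) (r : seq I) (d : nat) (y : 'cV[R]_d)
    (F : I -> 'cV[R]_d) :
  dot y (\sum_(i <- r) F i) = \sum_(i <- r) dot y (F i).
Proof.
by apply: (big_morph (dot y)); [move=> u v; exact: dotDr|exact: dot0r].
Qed.

Lemma conjugate_indic1 (d : nat) (b : 'cV[R]_d) :
  conjugate (@indic_fun R _ [set b]) = fun u => (dot b u)%:E.
Proof.
apply/funext => u; apply/eqP; rewrite eq_le; apply/andP; split.
  apply: ge_ereal_sup => _ [w _ <-]; rewrite /indic_fun.
  by case: ifPn => [|_]; [rewrite inE => ->; rewrite sube0|rewrite leNye].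
apply: ereal_sup_ubound; exists b => //.
by rewrite /indic_fun mem_set// sube0.
Qed.

Lemma Gamma0_dot (d : nat) (b : 'cV[R]_d) : Gamma0 (fun u => (dot b u)%:E).
Proof.
split.
- by split=> //; exists 0; rewrite /edom/= ltry.
- move=> u a; rewrite lte_fin => au.
  have near_u := @dot_continuous _ _ b u _ (lt_nbhsr au).
  by exists [set v | a < dot b v] => // v /=; rewrite lte_fin.
- by move=> u v t _; rewrite -!EFinM -EFinD lee_fin !dotE.
Qed.

(** The prolonged points lie on a line, hence in the affine hull, and tend to
    z0. *)
Lemma rel_interior_prolongable (d : nat) (S : set 'cV[R]_d) :
  rel_interior S `<=` prolongable S.
Proof.
move=> z0 [Sz0 nearS]; split=> // z Sz.
pose h (t : R) := t *: (z0 - z) + z.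
have hE t : h t = t *: z0 + (1 - t) *: z.
  by rewrite /h scalerBr scalerBl scale1r -addrA [- _ + _]addrC.
have hc : {for 1, continuous h}.
  apply: (@continuousD _ _ _ (fun t : R => t *: (z0 - z)) (fun=> z)).
    exact: scalel_continuous.
  exact: cst_continuous.
have h1 : h 1 = z0 by rewrite /h scale1r subrK.
rewrite /prop_for /continuous_at h1 in hc.
have /nbhs_ballP[e /= e0 he] := hc _ nearS.
exists (1 + e / 2); first by lra.
rewrite -hE; apply: he.
  by rewrite /ball/= opprD addrA subrr sub0r normrN gtr0_norm; lra.
by move=> M [affM SM]; rewrite hE; apply: affM; apply: SM.
Qed.

Context {s m : nat} {n_ : 'I_s -> nat}.
Variables (f : forall i, 'cV[R]_(n_ i) -> \bar R).
Variables (A : forall i, 'M[R]_(m, n_ i)) (b : 'cV[R]_m).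
Arguments f : clear implicits.
Hypothesis f_Gamma0 : forall i, Gamma0 (f i).
Implicit Types (x : forall i, 'cV[R]_(n_ i)) (y : 'cV[R]_m).

Let fN i u : f i u != -oo%E.
Proof. by have [[+ _] _ _] := f_Gamma0 i; exact. Qed.

(** The inequality makes -A_i^T y a subgradient of f_i at x_i. *)
Definition KKT x y : Prop :=
  \sum_(i < s) A i *m x i = b /\
  forall i u, (f i (x i) <= f i u + (dot ((A i)^T *m y) (u - x i))%:E)%E.

(** The equation for x_i is a subgradient inequality up to the factor
    alpha_i / beta. The one for y reads beta <b - sum_i A_i x_i, u - y> >= 0
    for all u, that is, sum_i A_i x_i = b. *)
Lemma fixed_point_eqsP (beta : R) (alpha : 'I_s -> R) x y :
  0 < beta -> (forall i, 0 < alpha i) ->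
  fixed_point_eqs f A b beta alpha x y <-> KKT x y.
Proof.
move=> beta0 alpha0.
have c0 i : 0 < alpha i / beta by rewrite divr_gt0.
have primal i := eq_proxP (x i) ((alpha i / beta) *: ((A i)^T *m y))
  (Gamma0_pscale (c0 i) (f_Gamma0 i)).
have subgE i u :
    ((alpha i / beta)%:E * f i (x i) <= (alpha i / beta)%:E * f i u
      + (dot ((alpha i / beta) *: ((A i)^T *m y)) (u - x i))%:E)%E
    = (f i (x i) <= f i u + (dot ((A i)^T *m y) (u - x i))%:E)%E.
  rewrite dotZl (EFinM (alpha i / beta)) -muleDr//.
    by rewrite lee_pmul2l ?lte_fin.
  exact: fin_num_adde_defl.
have dual := eq_proxP y (- (beta *: \sum_(i < s) A i *m x i))
  (Gamma0_pscale beta0 (Gamma0_dot b)).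
rewrite opprK in dual.
rewrite /fixed_point_eqs conjugate_indic1; split=> [[xprox yprox]|[Axb xmin]].
  split=> [|i u]; last by rewrite -subgE; exact: (primal i).1.
  pose w := b - \sum_(i < s) A i *m x i.
  (* testing at y - w leaves minus the squared norm of the residual w *)
  have := dual.1 yprox (y - w); rewrite -!EFinM -EFinD lee_fin.
  rewrite addrAC subrr add0r => H.
  have ww : beta * dot w w <= 0.
    by rewrite {1}/w; move: H; rewrite !dotE; lra.
  apply/esym/eqP; rewrite -subr_eq0 -/w; apply: contraTT ww => /dot_gt0 w0.
  by rewrite -ltNge mulr_gt0.
split=> [i|]; first by apply/(primal i) => u; rewrite subgE.
by apply/dual => u; rewrite -!EFinM -EFinD lee_fin Axb !dotE; lra.
Qed.

(** The linear terms add up to <y, sum_i A_i z_i - sum_i A_i x_i> = 0. *)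
Lemma KKT_solution x y : KKT x y -> is_solution f A b x.
Proof.
move=> [Axb xmin]; split=> // z /= Azb.
apply: (@le_trans _ _ (\sum_i (f i (z i)
    + (dot ((A i)^T *m y) (z i - x i))%:E))%E); first exact: lee_sum.
rewrite big_split/= sumEFin.
under [X in (_ + X%:E)%E]eq_bigr do rewrite dot_trmx mulmxBr.
by rewrite -dot_sumr sumrB Axb Azb subrr dot0r adde0.
Qed.

(** The multipliers of the scalar constraints (A z - b)_j = 0 on the product
    space form y. The inequality for f_i alone comes from moving only the i-th
    block of x, since the other finite terms cancel. *)
Lemma solution_KKT x :
  [set (\mxrow_(i < s) A i) *m z | z in rel_interior (edom (block_sum f))] b ->
  is_solution f A b x -> exists y, KKT x y.
Proof.
move=> [z0 riz0 Az0b] [/= Axb xmin].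
pose F (z : 'cV[R]_(\sum_(i < s) n_ i)) := fine (block_sum f z).
have domP z : edom (block_sum f) z ->
    forall i, f i (submxcol z i) \is a fin_num.
  by apply: sume_lty_fin_num => i; exact: fN.
have FE z : edom (block_sum f) z -> (F z)%:E = block_sum f z.
  by move=> Dz; rewrite fineK//; apply/sum_fin_numP => i _ _; exact: domP.
have AE z : (\mxrow_(i < s) A i) *m z = \sum_(i < s) A i *m submxcol z i.
  by rewrite -{1}(submxcolK z) mul_mxrow_mxcol.
pose X := \mxcol_i x i.
have XE : block_sum f X = (\sum_i f i (x i))%E.
  by apply: eq_bigr => i _; rewrite mxcolK.
have [Dz0 _] := riz0.
have DX : edom (block_sum f) X.
  rewrite /edom/= XE; apply: le_lt_trans Dz0.
  by apply: (xmin (fun i => submxcol z0 i)); rewrite /= -AE.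
have cvxF : convex_on (edom (block_sum f)) F.
  move=> z w t t01 Dz Dw.
  have le_conv : (block_sum f (t *: z + (1 - t) *: w)
      <= (t * F z + (1 - t) * F w)%:E)%E.
    rewrite EFinD !EFinM !FE// !fin_num_sume_distrr//; last 2 first.
    - by move=> i j _ _; rewrite fin_num_adde_defl// domP.
    - by move=> i j _ _; rewrite fin_num_adde_defl// domP.
    rewrite -big_split/=; apply: lee_sum => i _.
    have [_ _ cvx] := f_Gamma0 i.
    have -> : submxcol (t *: z + (1 - t) *: w) i
        = t *: submxcol z i + (1 - t) *: submxcol w i.
      by apply/matrixP => k l; rewrite !mxE.
    exact: cvx.
  have Dzw : edom (block_sum f) (t *: z + (1 - t) *: w).
    by apply: le_lt_trans le_conv _; rewrite ltry.
  by split=> //; rewrite -lee_fin FE.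
pose g (j : 'I_m) z := ((\mxrow_(i < s) A i) *m z - b) j 0.
have affg j : affine_fun (g j).
  by move=> z w t; rewrite /g mulmxDr -!scalemxAr !mxE; ring.
have gz0 j : g j z0 = 0 by rewrite /g Az0b subrr mxE.
have Fmin z : edom (block_sum f) z -> (forall j, g j z = 0) -> F X <= F z.
  move=> Dz gz; rewrite -lee_fin !FE// XE.
  apply: (xmin (fun i => submxcol z i)); rewrite /= -AE.
  by apply/eqP; rewrite -subr_eq0; apply/eqP/colP => j; rewrite [LHS]gz mxE.
have [y ymult] := lagrange_multipliers cvxF affg
  (rel_interior_prolongable riz0) gz0 Fmin.
exists (\col_j y j); split=> // i u.
have [->|uoo] := eqVneq (f i u) +oo%E; first by rewrite addye ?leey.
have ufin : f i u \is a fin_num by rewrite fin_numE fN.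
have xfin j : f j (x j) \is a fin_num.
  by have := domP _ DX j; rewrite mxcolK.
pose z := dfwith x i u.
have zi : z i = u by rewrite /z dfwithin.
have zj j : j != i -> z j = x j by move=> ji; rewrite /z dfwithout// eq_sym.
pose Z := \mxcol_j z j.
have ZE : block_sum f Z = (\sum_j f j (z j))%E.
  by apply: eq_bigr => j _; rewrite mxcolK.
have zfin j : f j (z j) \is a fin_num.
  by have [->|/zj ->] := eqVneq j i; rewrite ?zi.
have DZ : edom (block_sum f) Z.
  by rewrite /edom/= ZE -(EFin_sum_fine _ (fun j _ => zfin j)) ltry.
have := ymult _ DZ.
have -> : \sum_(j < m) y j * g j Z = dot (\col_j y j) (A i *m (u - x i)).
  apply: eq_bigr => j _; rewrite mxE; congr (_ * _ j 0).
  rewrite AE -Axb -sumrB (bigD1 i)//= big1 ?addr0; last first.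
    by move=> k ki; rewrite mxcolK zj// subrr.
  by rewrite mxcolK zi mulmxBr.
rewrite -dot_trmx -lee_fin EFinD !FE// XE ZE.
rewrite (bigD1 i)//= [in X in (_ <= X)%E -> _](bigD1 i)//= zi.
under [X in (_ <= _ + X + _)%E -> _]eq_bigr => j ji do rewrite zj//.
set T := (\sum_(j | j != i) f j (x j))%E.
have Tfin : T \is a fin_num by apply/sum_fin_numP => j _ _; exact: xfin.
by rewrite addeAC leeD2rE.
Qed.

End KKT.

Theorem theorem2p1 (R : realType) (s m : nat) (n_ : 'I_s -> nat)
    (s_gt0 : (0 < s)%N) (m_gt0 : (0 < m)%N) (n_gt0 : forall i, (0 < n_ i)%N)
    (f : forall i, 'cV[R]_(n_ i) -> \bar R) (A : forall i, 'M[R]_(m, n_ i))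
    (b : 'cV[R]_m)
    (f_Gamma0 : forall i, @Gamma0 R (n_ i) (f i))
    (b_in : [set (\mxrow_(i < s) A i) *m z
              | z in rel_interior (edom (block_sum f))] b) :
  (forall x : (forall i, 'cV[R]_(n_ i)),
     is_solution f A b x ->
     forall (beta : R) (alpha : 'I_s -> R),
       0 < beta -> (forall i, 0 < alpha i) ->
       exists y : 'cV[R]_m, fixed_point_eqs f A b beta alpha x y) /\
  (forall x : (forall i, 'cV[R]_(n_ i)),
     (exists (beta : R) (alpha : 'I_s -> R) (y : 'cV[R]_m),
        [/\ 0 < beta, forall i, 0 < alpha i
          & fixed_point_eqs f A b beta alpha x y]) ->
     is_solution f A b x).
Proof.
split=> [x xsol beta alpha beta0 alpha0|x [beta [alpha [y [beta0 alpha0]]]]].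
  have [y kkt] := solution_KKT f_Gamma0 b_in xsol.
  by exists y; apply/fixed_point_eqsP.
by move=> /fixed_point_eqsP-/(_ f_Gamma0 beta0 alpha0); exact: KKT_solution.
Qed.
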